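(* For any $\beta>0$, $\mu>0$ and $\alpha\in(0,1)$, there exist values $\gamma>0$ and $\epsilon>0$ satisfying the condition $$\begin{cases}\epsilon<\frac{\beta\gamma^2}{2}-\frac{\alpha\gamma\mu}{2},\\[2pt] \gamma>\frac{\alpha\mu}{\beta}.\end{cases}\qquad(\ast)$$ Moreover, for all parameters $\beta,\mu,\gamma,\epsilon>0$, $\alpha\in(0,1)$ satisfying $(\ast)$, a common quadratic Lyapunov function exists for the dynamic system $$\begin{cases}x'(t)=-\gamma y'(t)-\epsilon y(t),\\ y'(t)=\beta x(t)+\frac12\alpha\mu\,(w(t)-|y(t)|),\\ w'(t)=\beta x(t)+\frac12(\alpha-2)\mu\,(w(t)-|y(t)|),\end{cases}\qquad (x(t),y(t),w(t))\in\mathbb{R}^3,$$ and this system is exponentially stable.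
   Context: With $u(t)=(x(t),y(t),w(t))^T$, the dynamic system in the claim is a switched linear system: $u'(t)=A^+u(t)$ when $y(t)\ge 0$ and $u'(t)=A^-u(t)$ when $y(t)<0$, where $$A^{+}=\begin{pmatrix}-\gamma\beta & \frac12\gamma\alpha\mu-\epsilon & -\frac12\gamma\alpha\mu\\ \beta & -\frac12\alpha\mu & \frac12\alpha\mu\\ \beta & -\frac12(\alpha-2)\mu & \frac12(\alpha-2)\mu\end{pmatrix},\qquad A^{-}=\begin{pmatrix}-\gamma\beta & -\frac12\gamma\alpha\mu-\epsilon & -\frac12\gamma\alpha\mu\\ \beta & \frac12\alpha\mu & \frac12\alpha\mu\\ \beta & \frac12(\alpha-2)\mu & \frac12(\alpha-2)\mu\end{pmatrix}.$$ A function $V(u)=u^TPu$ is a quadratic Lyapunov function for a linear system $u'(t)=Au(t)$ if $P$ is a real symmetric positive definite matrix and $PA+A^TP$ is negative definite. A common quadratic Lyapunov function of the dynamic system in the claim is a function $V(u)=u^TPu$ that is a quadratic Lyapunov function for both $u'(t)=A^+u(t)$ and $u'(t)=A^-u(t)$. The system is exponentially stable if the origin is an exponentially stable equilibrium, i.e. there exist real constants $C>0$, $a>0$ such that $\|u(t)\|\le Ce^{-at}\|u(0)\|$ for all $t\ge0$ and all solutions $u(\cdot)$ of the system, where $\|\cdot\|$ is the Euclidean norm. *)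

(* Defs.v *)
From mathcomp Require Import all_boot all_order all_algebra.
From mathcomp Require Import all_classical all_reals all_analysis.
Set Implicit Arguments.
Unset Strict Implicit.
Unset Printing Implicit Defensive.
Import Order.TTheory GRing.Theory Num.Theory.
Import numFieldNormedType.Exports.
Local Open Scope ring_scope.

Definition mx3 (R : realType) (rows : seq (seq R)) : 'M[R]_3 :=
  \matrix_(i < 3, j < 3) nth 0 (nth [::] rows i) j.

Definition Aplus (R : realType) (alpha beta gamma epsilon mu : R) : 'M[R]_3 :=
  mx3 [:: [:: - (gamma * beta);
              2^-1 * gamma * alpha * mu - epsilon;
              - (2^-1 * gamma * alpha * mu)];
          [:: beta; - (2^-1 * alpha * mu); 2^-1 * alpha * mu];
          [:: beta; - (2^-1 * (alpha - 2) * mu); 2^-1 * (alpha - 2) * mu]].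

Definition Aminus (R : realType) (alpha beta gamma epsilon mu : R) : 'M[R]_3 :=
  mx3 [:: [:: - (gamma * beta);
              - (2^-1 * gamma * alpha * mu) - epsilon;
              - (2^-1 * gamma * alpha * mu)];
          [:: beta; 2^-1 * alpha * mu; 2^-1 * alpha * mu];
          [:: beta; 2^-1 * (alpha - 2) * mu; 2^-1 * (alpha - 2) * mu]].

Definition quad_form (R : realType) n (M : 'M[R]_n) (v : 'cV[R]_n) : R :=
  (v^T *m M *m v) 0 0.

Definition pos_def (R : realType) n (M : 'M[R]_n) : Prop :=
  forall v : 'cV[R]_n, v != 0 -> 0 < quad_form M v.

Definition neg_def (R : realType) n (M : 'M[R]_n) : Prop :=
  forall v : 'cV[R]_n, v != 0 -> quad_form M v < 0.

Definition quadratic_lyapunov (R : realType) n (A : 'M[R]_n)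
    (V : 'cV[R]_n -> R) : Prop :=
  exists P : 'M[R]_n,
    [/\ P^T = P, pos_def P, neg_def (P *m A + A^T *m P)
      & forall u, V u = quad_form P u].

Definition common_quadratic_lyapunov (R : realType)
    (alpha beta gamma epsilon mu : R) (V : 'cV[R]_3 -> R) : Prop :=
  quadratic_lyapunov (Aplus alpha beta gamma epsilon mu) V /\
  quadratic_lyapunov (Aminus alpha beta gamma epsilon mu) V.

(* The library norm on 'cV[R]_n is the max norm. *)
Definition euclidean_norm (R : realType) n (v : 'cV[R]_n) : R :=
  Num.sqrt (\sum_(i < n) v i 0 ^+ 2).

(* Solutions live on [0, +oo[: each coordinate is derivable on ]0, +oo[ and
   right-continuous at 0, and the equations hold on ]0, +oo[.  The right-hand
   side being continuous, the equations then also hold at 0 for the right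
   derivatives.  The values of u at negative times are irrelevant. *)
Definition is_solution (R : realType) (alpha beta gamma epsilon mu : R)
    (u : R -> 'cV[R]_3) : Prop :=
  let x := fun t => u t 0 0 in
  let y := fun t => u t 1 0 in
  let w := fun t => u t 2 0 in
  [/\ derivable_oy_Rcontinuous x 0, derivable_oy_Rcontinuous y 0,
      derivable_oy_Rcontinuous w 0 &
      forall t, 0 < t ->
      [/\ x^`()%classic t = - gamma * y^`()%classic t - epsilon * y t,
          y^`()%classic t = beta * x t + 2^-1 * alpha * mu * (w t - `|y t|) &
          w^`()%classic t =
            beta * x t + 2^-1 * (alpha - 2) * mu * (w t - `|y t|)]].

Definition exponentially_stable (R : realType) n
    (sol : (R -> 'cV[R]_n) -> Prop) : Prop :=
  exists C a : R, [/\ 0 < C, 0 < a &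
    forall u, sol u -> forall t, 0 <= t ->
      euclidean_norm (u t) <= C * expR (- a * t) * euclidean_norm (u 0)].

Definition param_condition (R : realType)
    (alpha beta gamma epsilon mu : R) : Prop :=
  epsilon < beta * gamma ^+ 2 / 2 - alpha * gamma * mu / 2 /\
  gamma > alpha * mu / beta.

(* Main.v *)
(* Write q1, q2, q3 for the successive time derivatives of q, and let
   k = alpha mu / 2.  With a, b, c as in the section phase_coordinates and
   phi = |y|, the system is equivalent to
     q3 + a q2 + b q1 + c q = phi,   y = - k q2,
   the variables x, y, w being linear combinations of q, q1, q2.  Completing
   time derivatives gives, for the quadratic form
     W = a q2^2 + 2b q2 q1 + 2c q2 q + (ab - c) q1^2 + 2ac q1 q + bc q^2,
   the identity
     phi^2 - y^2
       = W' + q3^2 + (a^2 - 2b - k^2) q2^2 + (b^2 - 2ac) q1^2 + c^2 q^2.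
   Both branches satisfy phi^2 = y^2, so W decreases strictly as soon as the
   two middle coefficients are positive; the parameter condition provides this,
   and the same two inequalities make W positive definite. *)
Require Import Defs.
From mathcomp Require Import all_boot all_order all_algebra.
From mathcomp Require Import all_classical all_reals all_analysis.
From mathcomp Require Import ring lra.
Set Implicit Arguments.
Unset Strict Implicit.
Unset Printing Implicit Defensive.
Import Order.TTheory GRing.Theory Num.Theory.
Import numFieldNormedType.Exports.
Local Open Scope classical_set_scope.
Local Open Scope ring_scope.

(** * Quadratic forms and their comparison *)

Lemma bilin_formE (R : realType) n (M : 'M[R]_n) (x y : 'cV[R]_n) :
  (x^T *m M *m y) 0 0 = \sum_(i < n) \sum_(j < n) x i 0 * M i j * y j 0.
Proof.
rewrite mxE exchange_big; apply: eq_bigr => j _ /=.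
by rewrite mxE mulr_suml; apply: eq_bigr => i _; rewrite mxE.
Qed.

Lemma quad_formE (R : realType) n (M : 'M[R]_n) (v : 'cV[R]_n) :
  quad_form M v = \sum_(i < n) \sum_(j < n) v i 0 * M i j * v j 0.
Proof. exact: bilin_formE. Qed.

Lemma quad_formZ (R : realType) n (M : 'M[R]_n) k (v : 'cV[R]_n) :
  quad_form M (k *: v) = k ^+ 2 * quad_form M v.
Proof.
rewrite !quad_formE mulr_sumr; apply: eq_bigr => i _.
by rewrite mulr_sumr; apply: eq_bigr => j _; rewrite !mxE; ring.
Qed.

Lemma quad_formN (R : realType) n (M : 'M[R]_n) (v : 'cV[R]_n) :
  quad_form (- M) v = - quad_form M v.
Proof. by rewrite /quad_form mulmxN mulNmx mxE. Qed.

Lemma quad_form0 (R : realType) n (M : 'M[R]_n) : quad_form M 0 = 0.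
Proof. by rewrite /quad_form mulmx0 mxE. Qed.

Lemma quad_form_congr (R : realType) n (M S : 'M[R]_n) (v : 'cV[R]_n) :
  quad_form (S^T *m M *m S) v = quad_form M (S *m v).
Proof. by rewrite /quad_form trmx_mul !mulmxA. Qed.

Lemma pos_def1 (R : realType) n : pos_def (1%:M : 'M[R]_n).
Proof.
move=> v v0; rewrite /quad_form mulmx1 mxE lt0r sumr_ge0; last first.
  by move=> i _; rewrite mxE -expr2 sqr_ge0.
rewrite andbT; apply: contra v0 => /eqP/psumr_eq0P h; apply/eqP/matrixP => i j.
rewrite ord1 mxE; apply/eqP; rewrite -sqrf_eq0 expr2.
by have := h _ i isT; rewrite mxE => -> // k _; rewrite mxE -expr2 sqr_ge0.
Qed.

Lemma quad_form1 (R : realType) n (v : 'cV[R]_n) :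
  quad_form 1%:M v = euclidean_norm v ^+ 2.
Proof.
rewrite /quad_form mulmx1 mxE sqr_sqrtr; last by apply: sumr_ge0 => i _; rewrite sqr_ge0.
by apply: eq_bigr => i _; rewrite mxE expr2.
Qed.

Lemma cvg_quad_form (R : realType) n (M : 'M[R]_n) (T : Type)
    (F : set_system T) {FF : Filter F} (u : T -> 'cV[R]_n) (l : 'cV[R]_n) :
  (forall i, u x i 0 @[x --> F] --> l i 0) ->
  quad_form M (u x) @[x --> F] --> quad_form M l.
Proof.
move=> ul; under eq_fun do rewrite quad_formE.
rewrite quad_formE; apply: cvg_big => [|i _]; first exact: add_continuous.
apply: cvg_big => [|j _]; first exact: add_continuous.
by apply: cvgM (ul j); apply: cvgM (ul i) _; exact: cvg_cst.
Qed.

Lemma continuous_quad_form (R : realType) n (M : 'M[R]_n) :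
  continuous (fun v : 'rV[R]_n => quad_form M v^T).
Proof.
move=> v; apply: (@cvg_quad_form _ _ M _ (nbhs v) _ trmx) => i; rewrite mxE.
by under eq_fun do rewrite mxE; exact: coord_continuous.
Qed.

(** On the compact unit sphere of the max norm, [P] attains a positive minimum and [Q] a maximum;
    homogeneity of degree two extends the comparison to all vectors. *)
Lemma pos_def_dominates (R : realType) n (P Q : 'M[R]_n) : pos_def P ->
  exists2 k : R, 0 < k & forall v, k * quad_form Q v <= quad_form P v.
Proof.
move=> P0; pose S : set 'rV[R]_n := [set v | `|v| = 1]%classic.
(* The sphere is empty exactly when [n] is 0, where the zero vector is the only one. *)
have [Se|/set0P Sn] := eqVneq S set0.
  exists 1 => // v; have [->|v0] := eqVneq v 0; first by rewrite !quad_form0 mulr0.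
  have vT0 : v^T != 0 by rewrite -(inj_eq (@trmx_inj _ _ _)) trmxK trmx0.
  suff : S (`|v^T|^-1 *: v^T) by rewrite Se.
  by rewrite /S /= normrZ normfV normr_id mulVf// normr_eq0.
have cS : compact S.
  apply: bounded_closed_compact.
    by exists 1; split=> // M M1 v /= ->; exact: ltW.
  rewrite (_ : S = (fun v : 'rV[R]_n => `|v|) @^-1` [set 1])%classic//.
  by apply: preimage_closed => [v _|]; [exact: norm_continuous|exact: closed_eq].
have cont M := continuous_subspaceT (A := S) (@continuous_quad_form R n M).
have [c cS1 minP] := compact_EVT_min Sn cS (cont P).
have [d dS1 maxQ] := compact_EVT_max Sn cS (cont Q).
set p := quad_form P c^T in minP; set q := quad_form Q d^T in maxQ.
have p0 : 0 < p.
  apply: P0; rewrite -(inj_eq (@trmx_inj _ _ _)) trmxK trmx0 -normr_eq0.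
  by move: cS1; rewrite inE /S /= => ->; rewrite oner_eq0.
(* The maximum [q] may be zero or negative; one plus its absolute value is a positive upper bound of
   [Q] on the sphere. *)
have q1 : 0 < `|q| + 1 by rewrite ltr_wpDl.
exists (p / (`|q| + 1)); first exact: divr_gt0.
move=> v; have [->|v0] := eqVneq v 0; first by rewrite !quad_form0 mulr0.
have vT0 : `|v^T| != 0.
  by rewrite normr_eq0 -(inj_eq (@trmx_inj _ _ _)) trmxK trmx0.
pose w := `|v^T|^-1 *: v^T.
have wS : w \in S by rewrite inE /S /= normrZ normfV normr_id mulVf.
have -> : v = `|v^T| *: w^T.
  by rewrite /w linearZ /= trmxK scalerA mulfV// scale1r.
rewrite !quad_formZ mulrCA ler_wpM2l ?sqr_ge0//.
apply: le_trans (minP _ wS).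
rewrite mulrAC ler_pdivrMr// ler_pM2l//.
by apply: (le_trans (maxQ _ wS)); rewrite (le_trans (ler_norm _))// lerDl.
Qed.

(** * Differentiation along trajectories and exponential decay *)

Lemma is_derive_sumr (R : realType) n (f : 'I_n -> R -> R) (df : 'I_n -> R)
    (t : R) : (forall i, is_derive t 1 (f i) (df i)) ->
  is_derive t 1 (fun s => \sum_(i < n) f i s) (\sum_(i < n) df i).
Proof.
move=> h; rewrite (_ : (fun s => _) = \sum_(i < n) f i); first exact: is_derive_sum.
by apply/funext => s; rewrite fct_sumE.
Qed.

(** The hypothesis concerns the single instant [t], so [A] can be whichever branch is active at that
    instant. *)
Lemma is_derive_quad_form (R : realType) n (P A : 'M[R]_n) (u : R -> 'cV[R]_n)
    (t : R) :
  (forall i, is_derive t 1 (fun s => u s i 0) ((A *m u t) i 0)) ->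
  is_derive t 1 (fun s => quad_form P (u s))
    (quad_form (P *m A + A^T *m P) (u t)).
Proof.
move=> du; set d := A *m u t in du.
rewrite (_ : (fun s => _) = (fun s => \sum_(i < n) \sum_(j < n)
    u s i 0 * P i j * u s j 0)); last by apply/funext => s; rewrite quad_formE.
suff -> : quad_form (P *m A + A^T *m P) (u t) = \sum_(i < n) \sum_(j < n)
    (u t i 0 * P i j * d j 0 + d i 0 * P i j * u t j 0).
  apply: is_derive_sumr => i; apply: is_derive_sumr => j.
  have dP := is_deriveM (du i) (is_derive_cst (P i j) t 1).
  apply: is_derive_eq (is_deriveM dP (du j)) _.
  by rewrite !fctE /GRing.scale /= /cst /=; ring.
rewrite /quad_form mulmxDr mulmxDl mxE !mulmxA -trmx_mul -(mulmxA _ A) -/d.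
by rewrite !bilin_formE -big_split; apply: eq_bigr => i _; rewrite -big_split.
Qed.

(** A Grönwall argument with V = [quad_form P]: at each positive time one branch gives V' <= - k V
    with the same [k], so e^(kt) V is nonincreasing whatever the pattern of switching. *)
Lemma exponentially_stable_of_common_lyapunov (R : realType) n
    (P A B : 'M[R]_n) (sol : (R -> 'cV[R]_n) -> Prop) :
  pos_def P -> neg_def (P *m A + A^T *m P) -> neg_def (P *m B + B^T *m P) ->
  (forall u, sol u ->
     (forall i, (fun t : R => u t i 0) @ 0^'+ --> u 0 i 0) /\
     (forall t : R, 0 < t ->
        (forall i, is_derive t 1 (fun s => u s i 0) ((A *m u t) i 0)) \/
        (forall i, is_derive t 1 (fun s => u s i 0) ((B *m u t) i 0)))) ->
  exponentially_stable sol.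
Proof.
move=> P0 NA NB solP.
have posN (N : 'M[R]_n) : neg_def N -> pos_def (- N).
  by move=> N0 v v0; rewrite quad_formN oppr_gt0 N0.
have [ka ka0 domA] := pos_def_dominates P (posN _ NA).
have [kb kb0 domB] := pos_def_dominates P (posN _ NB).
have [k1 k10 dom1] := pos_def_dominates 1%:M P0.
have [k2 k20 dom2] := pos_def_dominates P (@pos_def1 R n).
have P_ge0 v : 0 <= quad_form P v.
  by apply: le_trans (dom1 v); rewrite quad_form1 mulr_ge0 ?sqr_ge0 1?ltW.
pose k := Order.min ka kb.
have k0 : 0 < k by rewrite lt_min ka0.
(* The constants are the square roots of those in k1 |u(t)|^2 <= V(u(t)) <= e^(-kt) V(u(0)) <=
   e^(-kt) |u(0)|^2 / k2. *)
exists (Num.sqrt (k1 * k2)^-1), (k / 2).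
split; [by rewrite sqrtr_gt0 invr_gt0 mulr_gt0|by rewrite divr_gt0|].
move=> u /solP[u0 du] t t0.
have decV (s : R) : 0 < s -> exists2 l, is_derive s 1 (fun s => quad_form P (u s)) l &
    l <= - k * quad_form P (u s).
  have le_k : k <= ka /\ k <= kb by rewrite /k !ge_min !lexx orbT.
  move=> s0; case: (du s s0) => /(@is_derive_quad_form _ _ P) dV;
    (eexists; first exact: dV); rewrite mulNr lerNr -quad_formN.
    by apply: le_trans (domA _); rewrite ler_wpM2r ?P_ge0// le_k.1.
  by apply: le_trans (domB _); rewrite ler_wpM2r ?P_ge0// le_k.2.
pose f (s : R) := expR (k * s) * quad_form P (u s).
have df (s : R) : 0 < s -> exists2 l, is_derive s 1 f l & l <= 0.
  move=> /decV[l dl lle].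
  have de : is_derive s 1 (fun s : R => expR (k * s)) (k * expR (k * s)).
    have dk : is_derive s 1 (fun s : R => k * s) k.
      apply: is_derive_eq (is_deriveZ k (is_derive_id s 1)) _.
      by rewrite /GRing.scale /= mulr1.
    apply: is_derive_eq (is_derive1_comp (is_derive_expR _) dk) _.
    by rewrite /GRing.scale /= mulrC.
  eexists; first exact: is_deriveM de dl.
  rewrite /GRing.scale /=.
  have -> : expR (k * s) * l + quad_form P (u s) * (k * expR (k * s)) =
    expR (k * s) * (l + k * quad_form P (u s)) by ring.
  by rewrite pmulr_rle0 ?expR_gt0//; lra.
have fle : f t <= f 0.
  apply: (ler0_derive1_nincry (a := 0)) => //.
  - by move=> s; rewrite in_itv /= andbT => /df[l dl _]; exact: ex_derive.
  - move=> s; rewrite in_itv /= andbT => /df[l dl l0].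
    by rewrite derive1E derive_val.
  (* Derivatives are given at positive times only; right-continuity at 0 brings the initial value
     into the comparison. *)
  - apply: derivable_oy_Rcontinuous_within_itvcy; split.
      by move=> s; rewrite in_itv /= andbT => /df[l dl _]; exact: ex_derive.
    apply: cvgM.
      apply: cvg_at_right_filter.
      apply: (@continuous_comp _ _ _ (fun s : R => k * s) (@expR R)).
        exact: mulrl_continuous.
      exact: continuous_expR.
    exact: cvg_quad_form.
have key : k1 * euclidean_norm (u t) ^+ 2 <=
    expR (- (k * t)) * (euclidean_norm (u 0) ^+ 2 / k2).
  rewrite -!quad_form1; apply: (le_trans (dom1 _)).
  have -> : quad_form P (u t) = expR (- (k * t)) * f t.
    by rewrite /f mulrA -expRD addNr expR0 mul1r.
  rewrite ler_pM2l ?expR_gt0//; apply: (le_trans fle).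
  by rewrite /f mulr0 expR0 mul1r ler_pdivlMr// mulrC.
have Cge0 : 0 <= (k1 * k2)^-1 by rewrite invr_ge0 mulr_ge0 ?ltW.
have rhs0 : 0 <= Num.sqrt (k1 * k2)^-1 * expR (- (k / 2) * t) * euclidean_norm (u 0).
  by rewrite !mulr_ge0 ?sqrtr_ge0 ?expR_ge0.
rewrite -(ler_pXn2r (n := 2)) ?nnegrE ?sqrtr_ge0//.
rewrite !exprMn (sqr_sqrtr Cge0) -expRM_natl.
have -> : expR (2%:R * (- (k / 2) * t)) = expR (- (k * t)).
  by congr expR; field.
rewrite -(ler_pM2l k10); apply: (le_trans key).
by rewrite le_eqVlt; apply/orP; left; apply/eqP; field; rewrite !gt_eqF.
Qed.

(** * Change of coordinates *)

Lemma pos_def_congr (R : realType) n (M T : 'M[R]_n) :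
  T \in unitmx -> pos_def M -> pos_def (T^T *m M *m T).
Proof.
move=> Tu M0 v v0; rewrite quad_form_congr; apply: M0; apply: contra v0.
by move=> /eqP/(congr1 (mulmx (invmx T))); rewrite mulmxA mulVmx// mul1mx mulmx0 => ->.
Qed.

(** With T the inverse of [S], [P] is [M] read in the old coordinates, and P A + A^T P = T^T (M C +
    C^T M) T is a congruence. *)
Lemma lyapunov_similarity (R : realType) n (A C S M : 'M[R]_n) :
  S \in unitmx -> A *m S = S *m C -> neg_def (M *m C + C^T *m M) ->
  let P := (invmx S)^T *m M *m invmx S in neg_def (P *m A + A^T *m P).
Proof.
move=> Su AS N P v v0; set T := invmx S.
have TA : T *m A = C *m T.
  by rewrite -[A](mulmxK Su) AS !mulmxA mulVmx// mul1mx.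
have -> : P *m A + A^T *m P = T^T *m (M *m C + C^T *m M) *m T.
  rewrite /P -/T -mulmxA TA mulmxDr mulmxDl !mulmxA; congr (_ + _).
  by rewrite -!trmx_mul TA.
rewrite -oppr_gt0 -quad_formN -mulNmx -mulmxN.
apply: pos_def_congr v v0; first by rewrite unitmx_inv.
by move=> v v0; rewrite quad_formN oppr_gt0 N.
Qed.

(** * Dimension three: the storage form and its dissipation *)

Lemma big_ord3 (V : nmodType) (F : 'I_3 -> V) :
  \sum_(i < 3) F i = F 0 + F 1 + F 2.
Proof.
rewrite !big_ord_recl big_ord0 addr0 addrA.
by congr (F _ + F _ + F _); apply/val_inj.
Qed.

Lemma ord3P (i : 'I_3) : [\/ i = 0, i = 1 | i = 2].
Proof.
by case: i => [[|[|[|//]]] hi]; [apply: Or31|apply: Or32|apply: Or33]; apply/val_inj.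
Qed.

Lemma col3_eq0 (R : realType) (v : 'cV[R]_3) :
  (v == 0) = [&& v 0 0 == 0, v 1 0 == 0 & v 2 0 == 0].
Proof.
apply/eqP/and3P => [->|[/eqP v0 /eqP v1 /eqP v2]]; first by rewrite !mxE.
by apply/matrixP => i j; rewrite ord1 mxE; case: (ord3P i) => ->.
Qed.

Lemma matrix3P (R : realType) (A B : 'M[R]_3) :
  [/\ A 0 0 = B 0 0, A 0 1 = B 0 1 & A 0 2 = B 0 2] ->
  [/\ A 1 0 = B 1 0, A 1 1 = B 1 1 & A 1 2 = B 1 2] ->
  [/\ A 2 0 = B 2 0, A 2 1 = B 2 1 & A 2 2 = B 2 2] -> A = B.
Proof.
move=> [a00 a01 a02] [a10 a11 a12] [a20 a21 a22]; apply/matrixP.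
by move=> i j; case: (ord3P i) => ->; case: (ord3P j) => ->.
Qed.

(* The Gram matrix of W in the coordinates (q, q1, q2). *)
Definition storage (R : realType) (a b c : R) : 'M[R]_3 :=
  mx3 [:: [:: b * c; a * c; c]; [:: a * c; a * b - c; b]; [:: c; b; a]].

(* The equation q3 = - c q - b q1 - a q2 + phi with phi = - s q2; the branches
   phi = y and phi = - y are s = k and s = - k. *)
Definition companion (R : realType) (a b c s : R) : 'M[R]_3 :=
  mx3 [:: [:: 0; 1; 0]; [:: 0; 0; 1]; [:: - c; - b; - (a + s)]].

(** Squares are completed from [z] upwards: [a], [p] and [d / a] are the minors of the matrix taken
    from its lower right corner, [d / a] being the determinant. *)
Lemma storage_pos_def (R : realType) (a b c : R) : 0 < a -> 0 < b -> 0 < c ->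
  2 * b < a ^+ 2 -> 2 * a * c < b ^+ 2 -> pos_def (storage a b c).
Proof.
move=> a0 b0 c0 hab hbc v; rewrite col3_eq0 quad_formE !big_ord3 !mxE /=.
set x := v 0 0; set y := v 1 0; set z := v 2 0 => v0.
set F := (F in 0 < F).
pose p := a ^+ 2 * b - a * c - b ^+ 2.
pose d := a * c * (a ^+ 2 * b ^+ 2 - a ^+ 3 * c - b ^+ 3 + c ^+ 2).
have p0 : 0 < p by rewrite /p; nra.
have d0 : 0 < d.
  rewrite /d pmulr_rgt0 ?mulr_gt0//.
  (* Each hypothesis accounts for half of a^2 b^2: one half exceeds b^3, the other a^3 c. *)
  have : b ^+ 2 * (2 * b) < b ^+ 2 * a ^+ 2 by rewrite ltr_pM2l ?exprn_gt0.
  have : a ^+ 2 * (2 * a * c) < a ^+ 2 * b ^+ 2 by rewrite ltr_pM2l ?exprn_gt0.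
  by have := exprn_gt0 2 c0; lra.
have -> : F = (p * (c * x + b * y + a * z) ^+ 2
    + (p * y + c * (a ^+ 2 - b) * x) ^+ 2 + d * x ^+ 2) / (p * a).
  apply: (canRL (mulfK _)); first by rewrite mulf_neq0 ?gt_eqF.
  by rewrite /F /d /p; ring.
rewrite divr_gt0 ?mulr_gt0//.
have [x0|x0] := eqVneq x 0; last first.
  apply: ltr_wpDl; last by rewrite mulr_gt0// exprn_even_gt0.
  by rewrite addr_ge0 ?sqr_ge0// mulr_ge0 ?sqr_ge0// ltW.
rewrite x0 !mulr0 expr0n mulr0 addr0 addr0.
have [y0|y0] := eqVneq y 0.
  move: v0; rewrite x0 y0 !eqxx /= => z0.
  rewrite !mulr0 !add0r expr0n addr0 mulr_gt0// exprn_even_gt0//.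
  by rewrite mulf_neq0// gt_eqF.
apply: ltr_wpDl; first by rewrite mulr_ge0 ?sqr_ge0// ltW.
by rewrite exprn_even_gt0// mulf_neq0// gt_eqF.
Qed.

(** This is the completed-derivative identity with phi = - s q2; its first square is q3^2. The
    hypotheses see [s] only through its square, hence hold for both branches at once. *)
Lemma companion_dissipation (R : realType) (a b c s : R) :
  c != 0 -> 2 * b + s ^+ 2 < a ^+ 2 -> 2 * a * c < b ^+ 2 ->
  neg_def (storage a b c *m companion a b c s
           + (companion a b c s)^T *m storage a b c).
Proof.
move=> c0 hab hbc v; rewrite col3_eq0 quad_formE !big_ord3 !(mxE, big_ord3) /=.
set x := v 0 0; set y := v 1 0; set z := v 2 0 => v0.
rewrite [ltLHS](_ : _ = - ((c * x + b * y + (a + s) * z) ^+ 2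
  + (a ^+ 2 - (2 * b + s ^+ 2)) * z ^+ 2 + (b ^+ 2 - 2 * a * c) * y ^+ 2 + (c * x) ^+ 2)).
  have pz : 0 < a ^+ 2 - (2 * b + s ^+ 2) by rewrite subr_gt0.
  have py : 0 < b ^+ 2 - 2 * a * c by rewrite subr_gt0.
  rewrite oppr_lt0; have [x0|x0] := eqVneq x 0; last first.
    apply: ltr_wpDl; last by rewrite exprn_even_gt0// mulf_neq0.
    by rewrite !addr_ge0 ?sqr_ge0// mulr_ge0 ?sqr_ge0// ltW.
  move: v0; rewrite x0 eqxx mulr0 expr0n addr0 add0r /=.
  have [y0|y0 _] := eqVneq y 0; last first.
    apply: ltr_wpDl; last by rewrite mulr_gt0// exprn_even_gt0.
    by rewrite addr_ge0 ?sqr_ge0// mulr_ge0 ?sqr_ge0// ltW.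
  rewrite y0 expr0n !mulr0 addr0 /= => z0.
  by apply: ltr_wpDl; rewrite ?sqr_ge0// mulr_gt0// exprn_even_gt0.
by ring.
Qed.

(* The matrix sending (q, q1, q2) to (x, y, w). *)
Definition phase_mx (R : realType) (k beta gamma epsilon mu : R) : 'M[R]_3 :=
  mx3 [:: [:: 0; epsilon * k; gamma * k]; [:: 0; 0; - k];
          [:: mu * beta * epsilon; mu * beta * gamma; mu - k]].

Lemma phase_mx_unit (R : realType) (k beta gamma epsilon mu : R) :
  k != 0 -> beta != 0 -> epsilon != 0 -> mu != 0 ->
  phase_mx k beta gamma epsilon mu \in unitmx.
Proof.
move=> k0 b0 e0 m0.
(* Back substitution: y gives q2, then x gives q1, then w gives q. *)
pose T : 'M[R]_3 := mx3 [::
  [:: - gamma / (epsilon ^+ 2 * k);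
      ((mu - k) / k - mu * beta * gamma ^+ 2 / (epsilon * k)) / (mu * beta * epsilon);
      (mu * beta * epsilon)^-1];
  [:: (epsilon * k)^-1; gamma / (epsilon * k); 0];
  [:: 0; - k^-1; 0]].
suff /mulmx1_unit[] : phase_mx k beta gamma epsilon mu *m T = 1%:M by [].
by apply: matrix3P; split; rewrite !(mxE, big_ord3) /=; field; rewrite ?k0 ?b0 ?e0 ?m0.
Qed.

(** * The switched system in phase coordinates *)

Section phase_coordinates.
Variables (R : realType) (alpha beta gamma epsilon mu : R).
(** The branches have characteristic polynomials X^3 + (a + s) X^2 + b X + c, with s = k for [Aplus]
    and s = - k for [Aminus]. *)
Let k := 2^-1 * alpha * mu.
Let a := mu + beta * gamma - k.
Let b := beta * epsilon + mu * beta * gamma.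
Let c := mu * beta * epsilon.
Let S := phase_mx k beta gamma epsilon mu.

Lemma Aplus_phase_mx :
  Aplus alpha beta gamma epsilon mu *m S = S *m companion a b c k.
Proof.
by apply: matrix3P; split; rewrite !(mxE, big_ord3) /= /a /b /c /k; field.
Qed.

Lemma Aminus_phase_mx :
  Aminus alpha beta gamma epsilon mu *m S = S *m companion a b c (- k).
Proof.
by apply: matrix3P; split; rewrite !(mxE, big_ord3) /= /a /b /c /k; field.
Qed.

(** The matrix [storage a b c] does not involve the sign of the branch, so its transport by [S]
    serves both. *)
Lemma common_lyapunov_matrix :
  0 < beta -> 0 < mu -> 0 < gamma -> 0 < epsilon -> 0 < alpha < 1 ->
  param_condition alpha beta gamma epsilon mu ->
  exists P : 'M[R]_3, [/\ P^T = P, pos_def P,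
    neg_def (P *m Aplus alpha beta gamma epsilon mu
             + (Aplus alpha beta gamma epsilon mu)^T *m P) &
    neg_def (P *m Aminus alpha beta gamma epsilon mu
             + (Aminus alpha beta gamma epsilon mu)^T *m P)].
Proof.
move=> b0 m0 g0 e0 /andP[al0 al1] [he hg].
have k0 : 0 < k by rewrite /k !mulr_gt0// invr_gt0.
have km : 2 * k < mu by rewrite /k !mulrA mulfV// mul1r gtr_pMl.
have bg0 : 0 < beta * gamma by rewrite mulr_gt0.
have be0 : 0 < beta * epsilon by rewrite mulr_gt0.
have a0 : 0 < a by rewrite /a; lra.
have pb0 : 0 < b by rewrite /b -mulrA addr_gt0// mulr_gt0.
have c0 : 0 < c by rewrite /c !mulr_gt0.
(* The difference is mu (mu - 2k) + 2 beta (beta gamma^2 / 2 - alpha gamma mu / 2 - epsilon), whose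
   last factor is the margin in the bound on [epsilon]. *)
have gain : 2 * b + k ^+ 2 < a ^+ 2.
  have : beta * epsilon < beta * (beta * gamma ^+ 2 / 2 - alpha * gamma * mu / 2).
    by rewrite ltr_pM2l.
  have : 0 < mu * (mu - 2 * k) by rewrite mulr_gt0// subr_gt0.
  by rewrite /a /b /k; nra.
(* The difference is mu^2 beta (beta gamma^2 - 2 epsilon) + (beta epsilon)^2 + 2 k c. *)
have disc : 2 * a * c < b ^+ 2.
  have eg : 2 * epsilon < beta * gamma ^+ 2.
    have : 0 < alpha * gamma * mu by rewrite !mulr_gt0.
    by lra.
  have : 0 < mu ^+ 2 * beta * (beta * gamma ^+ 2 - 2 * epsilon).
    by rewrite !mulr_gt0 ?exprn_gt0// subr_gt0.
  have : 0 < (beta * epsilon) ^+ 2 by rewrite exprn_gt0.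
  have : 0 < 2 * k * c by rewrite !mulr_gt0.
  by rewrite /a /b /c; lra.
have Su : S \in unitmx by rewrite phase_mx_unit// gt_eqF.
exists ((invmx S)^T *m storage a b c *m invmx S); split.
- rewrite !trmx_mul trmxK mulmxA; congr (_ *m _ *m _).
  by apply: matrix3P; rewrite !mxE.
- by apply/pos_def_congr/storage_pos_def; rewrite ?unitmx_inv//; have := sqr_ge0 k; lra.
- apply: lyapunov_similarity Su Aplus_phase_mx _.
  by apply: companion_dissipation => //; rewrite gt_eqF.
- apply: lyapunov_similarity Su Aminus_phase_mx _.
  by apply: companion_dissipation => //; rewrite ?sqrrN// gt_eqF.
Qed.

Lemma solution_switched (u : R -> 'cV[R]_3) (t : R) :
  is_solution alpha beta gamma epsilon mu u -> 0 < t ->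
  (forall i, is_derive t 1 (fun s => u s i 0)
     ((Aplus alpha beta gamma epsilon mu *m u t) i 0)) \/
  (forall i, is_derive t 1 (fun s => u s i 0)
     ((Aminus alpha beta gamma epsilon mu *m u t) i 0)).
Proof.
move=> [[dx _] [dy _] [dw _] eqs] t0; have [ex ey ew] := eqs t t0.
have tin : t \in `]0, +oo[ by rewrite in_itv /= t0.
(* The equation for x' contains y'; substituting the value of y' yields the first row of the
   matrices. *)
have {}dx := derivableP (dx t tin); rewrite -derive1E ex ey in dx.
have {}dy := derivableP (dy t tin); rewrite -derive1E ey in dy.
have {}dw := derivableP (dw t tin); rewrite -derive1E ew in dw.
have [y0|y0] := leP 0 (u t 1 0); [left|right] => i.
all: by case: (ord3P i) => ->;
  [apply: is_derive_eq dx _|apply: is_derive_eq dy _|apply: is_derive_eq dw _];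
  rewrite !(mxE, big_ord3) /= ?(ger0_norm y0) ?(ltr0_norm y0); field.
Qed.

End phase_coordinates.

Theorem theorem3 (R : realType) :
  (forall beta mu alpha : R, 0 < beta -> 0 < mu -> 0 < alpha < 1 ->
     exists gamma epsilon : R,
       [/\ 0 < gamma, 0 < epsilon
         & param_condition alpha beta gamma epsilon mu])
  /\
  (forall beta mu gamma epsilon alpha : R,
     0 < beta -> 0 < mu -> 0 < gamma -> 0 < epsilon -> 0 < alpha < 1 ->
     param_condition alpha beta gamma epsilon mu ->
     (exists V : 'cV[R]_3 -> R,
        common_quadratic_lyapunov alpha beta gamma epsilon mu V)
     /\ exponentially_stable (is_solution alpha beta gamma epsilon mu)).
Proof.
split=> [beta mu alpha b0 m0 /andP[al0 _]|].
  (* Adding 1 makes beta gamma - alpha mu equal to [beta]. The upper bound on epsilon is then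
     [d / 2], and [d / 4] lies strictly below it. *)
  pose gamma := alpha * mu / beta + 1.
  pose d := gamma * (beta * gamma - alpha * mu).
  have g0 : 0 < gamma by rewrite ltr_wpDl// divr_ge0 ?mulr_ge0 ?ltW.
  have d0 : 0 < d.
    have -> : d = gamma * beta by rewrite /d /gamma; field; rewrite gt_eqF.
    by rewrite mulr_gt0.
  exists gamma, (d / 4); split=> //; first by rewrite divr_gt0.
  by split; [move: d0; rewrite /d; lra|rewrite /gamma ltrDl].
move=> beta mu gamma epsilon alpha b0 m0 g0 e0 al cond.
have [P [PT P0 NA NB]] := common_lyapunov_matrix b0 m0 g0 e0 al cond.
split; first by exists (quad_form P); split; exists P.
apply: exponentially_stable_of_common_lyapunov P0 NA NB _ => u sol; split.
  by case: sol => -[_ x0] [_ y0] [_ w0] _ i; case: (ord3P i) => ->.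
by move=> t; exact: solution_switched.
Qed.
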